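(* Let $G=(X,E,r)$ be an irreducible finite weighted directed graph, let $I\subseteq E$ be any subset of the edge set, and let $x\in X$. Then the rooted spanning tree polynomial satisfies $$\tau_x=\sum_{A\subseteq I}\tau_x^{\,\mathrm{del}\,A,\ \mathrm{con}\,(I\setminus A)},$$ where $A$ ranges over all subsets of $I$ (including $\varnothing$ and $I$ itself).
   Context: A weighted directed graph $G=(X,E,r)$ consists of a finite vertex set $X$, a set of directed edges $E\subseteq X\times X$ (an ordered pair $(x,y)\in E$ is an edge $x\to y$ with source $x$ and target $y$), and a positive weight $r:E\to\mathbb{R}_{>0}$. The edges $x\to y$ and $y\to x$ may carry different weights. For a subset $S\subseteq E$ write $r(S)=\prod_{e\in S}r(e)$, with $r(\varnothing)=1$. Irreducible means that there is a directed path between any two vertices, in each direction. A rooted spanning tree $T_x$ with root $x$ is a set of directed edges forming (when orientations are forgotten) a tree connecting all vertices of $X$, each edge being directed along the unique path leading to the root $x$. Equivalently, it is a spanning acyclic set of edges in which every vertex other than $x$ has exactly one outgoing edge and $x$ has none. In particular, it never contains both directions of an edge. For disjoint subsets $A,B\subseteq E$, the conditioned rooted spanning tree polynomial is $$\tau_x^{\,\mathrm{del}\,A,\ \mathrm{con}\,B}=\sum_{\substack{T_x:\ A\cap T_x=\varnothing,\\ B\subseteq T_x}}r(T_x),$$ the sum being over all spanning trees $T_x\subseteq E$ rooted at $x$ that contain no edge of $A$ and contain all edges of $B$ (an empty sum is $0$). The unconditioned polynomial is $\tau_x=\sum_{T_x}r(T_x)$, i.e. the case $A=B=\varnothing$.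 *)

(* Defs.v *)
From HB Require Import structures.
From mathcomp Require Export all_boot all_order all_algebra.
From mathcomp Require Export boolp reals.

Set Implicit Arguments.
Unset Strict Implicit.
Unset Printing Implicit Defensive.

Import Order.TTheory GRing.Theory Num.Theory.
Local Open Scope ring_scope.

(* An edge x -> y is the pair (x, y).  The weight is a total function on
   ordered pairs; only its values on [edges] are constrained and used. *)
Record wdigraph (R : realType) (X : finType) := WDigraph {
  edges : {set X * X};
  weight : X * X -> R;
  weight_gt0 : forall e, e \in edges -> 0 < weight e
}.

Definition irreducible (R : realType) (X : finType) (G : wdigraph R X) : Prop :=
  forall u v : X, connect [rel a b | (a, b) \in edges G] u v.

Definition set_weight (R : realType) (X : finType) (G : wdigraph R X)
    (S : {set X * X}) : R :=
  \prod_(e in S) weight G e.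

Definition undirected (X : finType) (T : {set X * X}) : rel X :=
  [rel u v | ((u, v) \in T) || ((v, u) \in T)].

(* Forgetting orientations yields a multigraph.  It has no cycle of length 1
   or 2 by the first clause (which rules out loops when u = v, and two
   opposite edges otherwise), and none of length at least 3 by the last. *)
Definition forms_spanning_tree (X : finType) (T : {set X * X}) : Prop :=
  [/\ forall u v : X, (u, v) \in T -> (v, u) \notin T,
      forall u v : X, connect (undirected T) u v
    & forall c : seq X, (2 < size c)%N -> ~~ ucycleb (undirected T) c].

(* In a tree the simple path from u to x is unique, so the second clause says
   that an edge u -> v is the first step of the path leading from u to x. *)
Definition rooted_spanning_tree (X : finType) (x : X) (T : {set X * X}) : Prop :=
  forms_spanning_tree T /\
  forall u v : X, (u, v) \in T ->
    exists p : seq X, [/\ path (undirected T) u (v :: p),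
                          uniq [:: u, v & p]
                        & last v p = x].

Definition spanning_trees (R : realType) (X : finType) (G : wdigraph R X)
    (x : X) : {set {set X * X}} :=
  [set T : {set X * X} | (T \subset edges G) && `[< rooted_spanning_tree x T >]].

Definition tau (R : realType) (X : finType) (G : wdigraph R X) (x : X) : R :=
  \sum_(T in spanning_trees G x) set_weight G T.

Definition tau_del_con (R : realType) (X : finType) (G : wdigraph R X) (x : X)
    (A B : {set X * X}) : R :=
  \sum_(T in spanning_trees G x | (A :&: T == set0) && (B \subset T))
    set_weight G T.

(* Main.v *)
Require Import Defs.
From mathcomp Require Import all_boot all_order all_algebra.
From mathcomp Require Import boolp reals.

(** A set [T] of edges determines how it splits [I]: the edges of [I] that it
    avoids are [I :\: T], and it contains all the others.  So the conditions of
    avoiding [A] and containing [I :\: A], with [A \subset I], hold for exactly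
    one [A], namely [A = I :\: T] ([setD_eq_avoid_contain]).  The right-hand
    side is therefore the sum over the spanning trees, grouped by the value of
    [I :\: T]. *)

Local Open Scope ring_scope.

Lemma setD_eq_avoid_contain (E : finType) (I T A : {set E}) :
  A \subset I ->
  (I :\: T == A) = (A :&: T == set0) && (I :\: A \subset T).
Proof.
move=> sAI; apply/eqP/andP => [<- | [/eqP AT0 sIAT]].
  by rewrite setDE -setIA (setIC _ T) setICr setI0 -setDE setDDr setDv set0U
             subsetIr eqxx.
(* As [I] is [A] together with [I :\: A], removing [T] leaves exactly [A]. *)
rewrite -(setID I A) setDUl (setIidPr sAI).
have /eqP-> : (I :\: A) :\: T == set0 by rewrite setD_eq0.
by rewrite setU0; apply/setDidPl; rewrite -setI_eq0 AT0.
Qed.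

Theorem theorem1 (R : realType) (X : finType) (G : wdigraph R X)
    (hG : irreducible G) (I : {set X * X}) (hI : I \subset edges G) (x : X) :
  tau G x = \sum_(A : {set X * X} | A \subset I) tau_del_con G x A (I :\: A).
Proof.
rewrite /tau /tau_del_con.
rewrite (partition_big (fun T => I :\: T) (fun A => A \subset I)) /=; last first.
  by move=> T _; apply: subsetDl.
apply: eq_bigr => A sAI; apply: eq_bigl => T.
by rewrite setD_eq_avoid_contain.
Qed.
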